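(* Let $\alpha\notin\mathbb Z$ and let $\beta$ be arbitrary. The character and supercharacter of the $U_q[\widehat{gl(2|2)}]$-module $\mathcal F_{(\alpha;\beta)}$ are $$Ch_{\mathcal F_{(\alpha;\beta)}}(q,x_1,x_2,x_3,x_4)=\frac{q^{\frac12\alpha(2\beta+1)}}{\prod_{n=1}^\infty(1-q^n)^6}\sum_{i,j,k\in\mathbb Z}q^{\frac12(i^2+j^2+k^2-2kj+i+j+k)}\,x_1^{\alpha+j}x_2^{1-\alpha+i-k}x_3^{-j}x_4^{4\beta+2-\alpha+2i-2j+2k},$$ $$Sch_{\mathcal F_{(\alpha;\beta)}}(q,x_1,x_2,x_3,x_4)=\frac{q^{\frac12\alpha(2\beta+1)}}{\prod_{n=1}^\infty(1-q^n)^6}\sum_{i,j,k\in\mathbb Z}(-1)^{\alpha-1+i-j+k}q^{\frac12(i^2+j^2+k^2-2kj+i+j+k)}\,x_1^{\alpha+j}x_2^{1-\alpha+i-k}x_3^{-j}x_4^{4\beta+2-\alpha+2i-2j+2k}.$$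
   Context: Here $q$ is the deformation parameter of the quantum affine superalgebra $U_q[\widehat{gl(2|2)}]$, and $[x]_q=(q^x-q^{-x})/(q-q^{-1})$. Oscillators: $a^j_n,Q_{a^j}$ ($1\le j\le4$), $c^l_n,Q_{c^l}$ ($l=1,2$), $n\in\mathbb Z$, with $[a^j_n,a^{j'}_m]=(-1)^{j+1}\delta_{jj'}\delta_{m+n,0}\frac{[n]_q^2}n$ and $[c^l_n,c^{l'}_m]=\delta_{ll'}\delta_{m+n,0}\frac{[n]_q^2}n$, $[a^j_0,Q_{a^{j'}}]=\delta_{jj'}$, $[c^l_0,Q_{c^{l'}}]=\delta_{ll'}$, all other commutators zero (in particular the zero modes $a^j_0,c^l_0$ commute with each other). The vacuum satisfies $a^j_m|0\rangle=c^l_m|0\rangle=0$ for $m\ge0$; put $|\lambda_1,\lambda_2,\lambda_3,\lambda_4;\lambda_5,\lambda_6\rangle=e^{\sum_{i=1}^4\lambda_iQ_{a^i}+\lambda_5Q_{c^1}+\lambda_6Q_{c^2}}|0\rangle$, and let $F_{\lambda_1,\lambda_2,\lambda_3,\lambda_4;\lambda_5,\lambda_6}$ be the Fock space generated from it by the $a^j_{-m},c^l_{-m}$, $m>0$. Define $$\mathcal F_{(\alpha;\beta)}=\bigoplus_{i,j,k\in\mathbb Z}F_{\beta+1+i,\,-\beta-1+\alpha-i+j,\,\beta-j+k,\,-\beta-k;\,-\alpha+i-j,\,k}.$$ It is a level-one $U_q[\widehat{gl(2|2)}]$-module under the free boson realization, in which the Cartan generator $h_j$ acts as $A^j_0$ ($1\le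 j\le4$) and the derivation $d$ acts as given below. $A^i_n=(-1)^{i+1}(a^i_n+a^{i+1}_n)$ ($i=1,2,3$), $A^4_n=\frac{q^n+q^{-n}}2\sum_{l=1}^4(-1)^{l+1}a^l_n$. Let $(a_{ij})_{1\le i,j\le4}$ be the symmetric invertible matrix with zero diagonal and $a_{12}=1$, $a_{23}=-1$, $a_{13}=0$, $a_{14}=2$, $a_{24}=-2$, $a_{34}=2$; $a^{-1}_{ij}$ denotes the entries of its inverse. Put $A^{*i}_n=\sum_{l=1}^3a^{-1}_{il}A^l_n+\frac2{q^n+q^{-n}}a^{-1}_{i4}A^4_n$ ($i=1,2,3$), $A^{*4}_n=4\sum_{l=1}^4a^{-1}_{4l}A^l_n$ ($n\ne0$), and $A^{*j}_0=\sum_{l=1}^4a^{-1}_{jl}A^l_0$ ($1\le j\le 4$). Then $$d=-\sum_{m>0}\frac{m^2}{[m]_q^2}\Big\{\sum_{i=1}^3A^i_{-m}A^{*i}_m+\frac1{2(q^m+q^{-m})}A^4_{-m}A^{*4}_m+c^1_{-m}c^1_m+c^2_{-m}c^2_m\Big\}-\frac12\Big\{\sum_{i=1}^4A^i_0A^{*i}_0+c^1_0(c^1_0+1)+c^2_0(c^2_0+1)\Big\}.$$ The character and supercharacter of a module $M$ are $Ch_M(q,x_1,x_2,x_3,x_4)=\mathrm{tr}_M(q^{-d}x_1^{h_1}x_2^{h_2}x_3^{h_3}x_4^{h_4})$ and $Sch_M(q,x_1,x_2,x_3,x_4)=\mathrm{Str}_M(q^{-d}x_1^{h_1}x_2^{h_2}x_3^{h_3}x_4^{h_4})=\mathrm{tr}_M((-1)^{N_f}q^{-d}x_1^{h_1}x_2^{h_2}x_3^{h_3}x_4^{h_4})$,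 where $N_f=a^2_0+a^4_0$ is the Fermi-number operator.
   Formalization: The supercharacter sign is corrected to (-1)^{α-1-2β+i-j+k}, as N_f gives (the printed one fails e.g. at β=1/2); the printed formula is proved when (-1)^{2β}=1 (principal branch). Characters are formal series, q is nonzero and not a root of unity. *)

(* Defs.v *)
From HB Require Import structures.
From mathcomp Require Import all_boot all_order all_algebra.
From mathcomp Require Import complex.
From mathcomp Require Import all_classical all_reals all_analysis.

Set Implicit Arguments.
Unset Strict Implicit.
Unset Printing Implicit Defensive.

Import Order.TTheory GRing.Theory Num.Theory.

Local Open Scope ring_scope.

(* The complex numbers are R[i] for R : realType.  Families
   indexed by 1, ..., n on paper are indexed here by 'I_n = {0, ..., n-1}, so
   that the sign (-1)^{j+1} becomes (-1)^j. *)

Section Oscillators.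
Context {R : realType}.
Local Notation C := R[i].

Definition qint (q : C) (n : int) : C := (q ^ n - q ^ (- n)) / (q - q^-1).

(* A representation of the oscillator algebra on V with a vacuum vector.  The
   operators Q enter only through the exponentials
     osc_E la mu = exp (\sum_j la_j Q_{a^j} + \sum_l mu_l Q_{c^l}),
   for which [x_n, Q] = delta_{n,0} (x = a^j or c^l, Q its conjugate) reads
   [x_n, e^{tQ}] = delta_{n,0} t e^{tQ}, and the commutation of the Q's reads
   osc_ED.  For n = 0 the factor qint q n ^+ 2 / n%:~R is 0, so the zero modes
   commute. *)
Record oscillators (q : C) (V : lmodType C) := Oscillators {
  osc_a : 'I_4 -> int -> {linear V -> V};
  osc_c : 'I_2 -> int -> {linear V -> V};
  osc_E : 'rV[C]_4 -> 'rV[C]_2 -> {linear V -> V};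
  osc_vac : V;
  osc_aa : forall j j' n m v,
    osc_a j n (osc_a j' m v) - osc_a j' m (osc_a j n v) =
    (if (j == j') && (m + n == 0)
     then (-1) ^+ j * (qint q n ^+ 2 / n%:~R) else 0) *: v;
  osc_cc : forall l l' n m v,
    osc_c l n (osc_c l' m v) - osc_c l' m (osc_c l n v) =
    (if (l == l') && (m + n == 0) then qint q n ^+ 2 / n%:~R else 0) *: v;
  osc_ac : forall j l n m v,
    osc_a j n (osc_c l m v) = osc_c l m (osc_a j n v);
  osc_aE : forall j n la mu v,
    osc_a j n (osc_E la mu v) - osc_E la mu (osc_a j n v) =
    (if n == 0 then la 0 j else 0) *: osc_E la mu v;
  osc_cE : forall l n la mu v,
    osc_c l n (osc_E la mu v) - osc_E la mu (osc_c l n v) =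
    (if n == 0 then mu 0 l else 0) *: osc_E la mu v;
  osc_E0 : forall v, osc_E 0 0 v = v;
  osc_ED : forall la mu la' mu' v,
    osc_E la mu (osc_E la' mu' v) = osc_E (la + la') (mu + mu') v;
  osc_vac_neq0 : osc_vac != 0;
  osc_a_vac : forall j (m : nat), osc_a j m osc_vac = 0;
  osc_c_vac : forall l (m : nat), osc_c l m osc_vac = 0
}.

Section Operators.
Variables (q : C) (V : lmodType C) (O : oscillators q V).
Local Notation a := (osc_a O).
Local Notation c := (osc_c O).

Inductive fock (la : 'rV[C]_4) (mu : 'rV[C]_2) : V -> Prop :=
| fock_ket : fock la mu (osc_E O la mu (osc_vac O))
| fock_a j (m : nat) v of (0 < m)%N & fock la mu v :
    fock la mu (a j (- m%:Z) v)
| fock_c l (m : nat) v of (0 < m)%N & fock la mu v :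
    fock la mu (c l (- m%:Z) v)
| fock_zero : fock la mu 0
| fock_lin (x : C) u v of fock la mu u & fock la mu v :
    fock la mu (x *: u + v).

Definition lambda_a (alpha beta : C) (i j k : int) : 'rV[C]_4 :=
  \row_s [:: beta + 1 + i%:~R;
             - beta - 1 + alpha - i%:~R + j%:~R;
             beta - j%:~R + k%:~R;
             - beta - k%:~R]`_s.

Definition lambda_c (alpha : C) (i j k : int) : 'rV[C]_2 :=
  \row_s [:: - alpha + i%:~R - j%:~R; k%:~R]`_s.

(* The sum over i, j, k of the Fock spaces, as a subspace of V.  The sum is
   direct: the zero modes act on the summands by pairwise distinct weights. *)
Inductive calF (alpha beta : C) : V -> Prop :=
| calF_fock i j k v of
    fock (lambda_a alpha beta i j k) (lambda_c alpha i j k) v :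
    calF alpha beta v
| calF_add u v of calF alpha beta u & calF alpha beta v :
    calF alpha beta (u + v).

Definition opA (i : 'I_4) (n : int) (v : V) : V :=
  if (i < 3)%N then (-1) ^+ i *: (a i n v + a (inord i.+1) n v)
  else ((q ^ n + q ^ (- n)) / 2) *: \sum_(l < 4) (-1) ^+ l *: a l n v.

Definition amat : 'M[C]_4 := \matrix_(i, j)
  (nth [::] [:: [:: 0;  1;  0;  2];
                [:: 1;  0; -1; -2];
                [:: 0; -1;  0;  2];
                [:: 2; -2;  2;  0]] i)`_j.

Definition ainv : 'M[C]_4 := invmx amat.

Definition opAs (i : 'I_4) (n : int) (v : V) : V :=
  if n == 0 then \sum_(l < 4) ainv i l *: opA l n v
  else if (i < 3)%N then
    \sum_(l < 4 | (l < 3)%N) ainv i l *: opA l n v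
    + (2 / (q ^ n + q ^ (- n)) * ainv i ord_max) *: opA ord_max n v
  else 4 *: \sum_(l < 4) ainv i l *: opA l n v.

Definition oph (j : 'I_4) : V -> V := opA j 0.

(* On a vector of calF only finitely many m contribute; elsewhere the finitely
   supported sum may be a junk 0. *)
Definition opd (v : V) : V :=
  - (\sum_(m \in [set m : nat | (0 < m)%N]%classic)
       (m%:R ^+ 2 / qint q m ^+ 2) *:
       (\sum_(i < 4 | (i < 3)%N) opA i (- m%:Z) (opAs i m v)
        + (1 / (2 * (q ^ m%:Z + q ^ (- m%:Z)))) *:
            opA ord_max (- m%:Z) (opAs ord_max m v)
        + \sum_(l < 2) c l (- m%:Z) (c l m v)))
  - (1 / 2) *:
    (\sum_(i < 4) opA i 0 (opAs i 0 v)
     + \sum_(l < 2) c l 0 (c l 0 v + v)).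

Definition opNf (v : V) : V := a (inord 1) 0 v + a (inord 3) 0 v.

End Operators.

(* The principal branch exp (i pi z) of (-1)^z. *)
Definition m1pow (z : C) : C :=
  let x := complex.Re z in
  let y := complex.Im z in
  Complex (expR (- (pi * y)) * cos (pi * x)) (expR (- (pi * y)) * sin (pi * x)).

(* Formal (generalized) series in q and x_1, ..., x_4 with complex exponents:
   f e mu is the coefficient of q^e x^mu.  Characters are such series; the sums
   over Z^3 below converge for no values of the variables, but each monomial in
   the x's receives a genuine power series in q (up to a shift). *)
Definition fseries := C -> 'rV[C]_4 -> C.

Section Trace.
Variable V : lmodType C.

(* t is the trace over the finite-dimensional subspace W of f(T), for an
   operator T that is diagonalizable on W; f(T) multiplies the nu-eigenspace of
   T by f nu. *)
Definition fun_trace (W : V -> Prop) (f : C -> C) (T : V -> V) (t : C) : Prop :=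
  exists (n : nat) (b : 'I_n -> V) (nu : 'I_n -> C),
  [/\ forall x : 'I_n -> C, \sum_s x s *: b s = 0 -> forall s, x s = 0,
      forall v, W v <-> exists x : 'I_n -> C, v = \sum_s x s *: b s,
      forall s, T (b s) = nu s *: b s &
      t = \sum_s f (nu s)].

Definition weight_space (M : V -> Prop) (d : V -> V) (h : 'I_4 -> V -> V)
    (e : C) (mu : 'rV[C]_4) (v : V) : Prop :=
  [/\ M v, - d v = e *: v & forall j, h j v = mu 0 j *: v].

(* ch is tr_M (f(T) q^{-d} x_1^{h_1} x_2^{h_2} x_3^{h_3} x_4^{h_4}). *)
Definition formal_trace (M : V -> Prop) (f : C -> C) (T : V -> V)
    (d : V -> V) (h : 'I_4 -> V -> V) (ch : fseries) : Prop :=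
  (forall v, M v -> exists (n : nat) (u : 'I_n -> V),
     (forall s, exists e mu, weight_space M d h e mu (u s)) /\
     v = \sum_s u s) /\
  (forall e mu, fun_trace (weight_space M d h e mu) f T (ch e mu)).

Definition is_Ch (M : V -> Prop) (d : V -> V) (h : 'I_4 -> V -> V) :=
  formal_trace M id id d h.

Definition is_Sch (M : V -> Prop) (Nf d : V -> V) (h : 'I_4 -> V -> V) :=
  formal_trace M m1pow Nf d h.

End Trace.

(* The series \sum_(i,j,k) s i j k * q^(e i j k) * x^(mu i j k), for families
   in which each monomial occurs finitely often. *)
Definition fs_sumZ3 (s e : int -> int -> int -> C)
    (mu : int -> int -> int -> 'rV[C]_4) : fseries := fun e0 mu0 =>
  \sum_(p \in [set p : int * int * int |
      e p.1.1 p.1.2 p.2 = e0 /\ mu p.1.1 p.1.2 p.2 = mu0]%classic)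
    s p.1.1 p.1.2 p.2.

Definition fs_qpow (e1 : C) (f : fseries) : fseries :=
  fun e mu => f (e - e1) mu.

(* The product of f with the power series \sum_N p N * q^N, for f such that
   only finitely many terms contribute to each coefficient. *)
Definition fs_mulq (p : nat -> C) (f : fseries) : fseries :=
  fun e mu => \sum_(N \in [set: nat]%classic) p N * f (e - N%:R) mu.

Fixpoint ps_inv_seq (p : nat -> C) (n : nat) : seq C :=
  if n is n'.+1 then
    let s := ps_inv_seq p n' in
    rcons s (((n' == 0%N)%:R - \sum_(k < n') p (n' - k)%N * s`_k) / p 0%N)
  else [::].

(* The inverse of the power series p, when p 0 != 0. *)
Definition ps_inv (p : nat -> C) : nat -> C :=
  fun n => (ps_inv_seq p n.+1)`_n.

(* The power series \prod_(n >= 1) (1 - q^n)^6; the factors with n > N do not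
   affect its coefficient of q^N. *)
Definition euler6 : nat -> C :=
  fun N => (\prod_(1 <= n < N.+1) (1 - 'X^n : {poly C}) ^+ 6)`_N.

End Oscillators.

(* Main.v *)
Require Import Defs.
From HB Require Import structures.
From mathcomp Require Import all_boot all_order all_algebra.
From mathcomp Require Import complex.
From mathcomp Require Import all_classical all_reals all_analysis.
From mathcomp Require Import ring zify.

Set Implicit Arguments.
Unset Strict Implicit.
Unset Printing Implicit Defensive.

Import Order.TTheory GRing.Theory Num.Theory.

Local Open Scope ring_scope.

(** The module is a direct sum of Fock spaces indexed by (i, j, k), and each of
    them has the basis of monomials in the creation operators of six bosons.
    Every monomial is a joint eigenvector of d and of the h_j, so the character
    is a sum over (i, j, k) of one monomial in the x_s times the generating
    function of the levels. Three facts make this precise.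

    The derivation is the sum of the number operators. The matrix (a_ij) is the
    Gram matrix of the currents A^1, A^2, A^3 and a rescaled A^4 for the form
    diag(1, -1, 1, -1) of the a-bosons, so pairing the currents with its inverse
    gives back the diagonal quadratic expression in the a's [curr_casimir]. The
    powers of q attached to A^4 cancel because the last diagonal entry of the
    inverse vanishes. On a monomial, the part of -d of positive frequency is
    then the level [sum_count_level], and the zero modes contribute the exponent
    of the ground state [opd_trunc_vec].

    Monomials of one level, counted without regard to order, are independent
    [mono_free]: the annihilation monomials form a dual family up to nonzero
    scalars. This uses [n]_q != 0, i.e. that q is not a root of unity.

    The charges determine (i, j, k) [charge_inj], so that a weight space is
    either 0 or spanned by the monomials of one level N in one Fock space
    [weight_space_basis]. Their number is the coefficient of X^N in
    the inverse of the product of the (1 - X^n)^6 [ps_inv_euler6], since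
    expanding the product of the geometric series of all modes enumerates
    occupation numbers. The operator (-1)^N_f is a scalar on each Fock space,
    and its eigenvalue agrees with the stated sign because m1pow has period 2;
    the term 2 beta in its exponent can be dropped when m1pow (2 beta) = 1. *)

(** * The inverse of the Euler product counts occupation numbers *)

Section PowerSeries.
Context {R : realType}.
Local Notation C := R[i].

(** The coefficients up to order N are determined by the convolution identities
    up to order N, so a polynomial that inverts p modulo X^(N+1) suffices. *)
Lemma ps_inv_unique (p g : nat -> C) N :
    p 0%N != 0 ->
    (forall n, (n <= N)%N ->
       \sum_(k < n.+1) p (n - k)%N * g k = (n == 0%N)%:R) ->
  ps_inv p N = g N.
Proof.
move=> p0 pg.
have H : forall n, (n <= N.+1)%N -> ps_inv_seq p n = mkseq g n.
  elim=> [|n IHn] ltnN //=; rewrite mkseqS (IHn (ltnW ltnN)).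
  congr rcons; apply: (mulIf p0); rewrite divfK // -(pg n ltnN).
  rewrite big_ord_recr /= subnn addrAC mulrC -[RHS]add0r; congr (_ + _).
  apply/eqP; rewrite subr_eq0; apply/eqP.
  by apply: eq_bigr => k _; rewrite nth_mkseq.
by rewrite /ps_inv H // nth_mkseq.
Qed.

(** Factors 1 - X^w with w > k are 1 modulo X^(k+1); all truncations of infinite
    products rest on this. *)
Lemma coef_mul_prod_1subXn (I : Type) (r : seq I) (w : I -> nat)
    (P : {poly C}) k :
    all (fun i => (k < w i)%N) r ->
  (P * \prod_(i <- r) (1 - 'X^(w i)))`_k = P`_k.
Proof.
elim: r P => [|i r IHr] P /=; first by rewrite big_nil mulr1.
move=> /andP[kwi kwr].
by rewrite big_cons mulrA IHr // mulrBr mulr1 coefB coefMXn kwi subr0.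
Qed.

Lemma euler6_coef N k : (k <= N)%N ->
  euler6 k = (\prod_(1 <= n < N.+1) (1 - 'X^n : {poly C}) ^+ 6)`_k.
Proof.
move=> kN; rewrite /euler6 [in RHS](big_cat_nat (n := k.+1)) //=.
have drop_high (P : {poly C}) e :
    (P * (\prod_(k.+1 <= n < N.+1) (1 - 'X^n)) ^+ e)`_k = P`_k.
  elim: e => [|e IHe]; first by rewrite expr0 mulr1.
  rewrite exprSr mulrA coef_mul_prod_1subXn //.
  by apply/allP => n; rewrite mem_index_iota => /andP[].
by rewrite [X in polyseq (_ * X)]prodrXl drop_high.
Qed.

(** Each product (1 - X^w) (1 + X^w + ... + X^(N w)) telescopes to
    1 - X^((N+1) w), which is 1 modulo X^(N+1). *)
Lemma coef_prod_geometric (T : finType) (w : T -> nat) N n :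
    (forall t, (0 < w t)%N) -> (n <= N)%N ->
  (\prod_t (1 - 'X^(w t)) *
   \prod_t \sum_(k < N.+1) 'X^(k * w t) : {poly C})`_n = (n == 0%N)%:R.
Proof.
move=> w_gt0 nN; rewrite -big_split /=.
have E t : (1 - 'X^(w t)) * \sum_(k < N.+1) 'X^(k * w t) =
    1 - 'X^(N.+1 * w t) :> {poly C}.
  rewrite mulnC exprM; apply: oppr_inj; rewrite -mulNr !opprB [RHS]subrX1.
  congr (_ * _).
  by apply: eq_bigr => k _; rewrite -exprM mulnC.
under eq_bigr do rewrite E.
rewrite -[\prod_t _]mul1r coef_mul_prod_1subXn ?coef1 //.
apply/allP => t _ /=; apply: (leq_ltn_trans nN).
exact: leq_pmulr.
Qed.

(** Expanding the product chooses a power of X^(w t) for each t, that is, an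
    occupation number. *)
Lemma coef_prod_occupation (T : finType) (w : T -> nat) N n :
  (\prod_t \sum_(k < N.+1) 'X^(k * w t) : {poly C})`_n =
  #|[set f : {ffun T -> 'I_N.+1} | (\sum_t f t * w t)%N == n]|%:R.
Proof.
rewrite bigA_distr_bigA coef_sum -sum1_card natr_sum [RHS]big_mkcond /=.
apply: eq_bigr => f _; rewrite inE -expr_sum coefXn eq_sym.
by case: eqP.
Qed.

End PowerSeries.

Definition colour : finType := ('I_4 + 'I_2)%type.

(** The pair (x, m) stands for the oscillators of colour x and frequencies m + 1
    and -(m + 1), so that every pair is a genuine mode. *)
Definition mode : eqType := (colour * nat)%type.

Section Counting.
Context {R : realType}.
Local Notation C := R[i].

(** At level N only frequencies up to N occur, each at most N times. *)
Definition occupation N : finType := {ffun colour * 'I_N -> 'I_N.+1}.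

Definition occ_level N (f : occupation N) : nat := (\sum_s f s * s.2.+1)%N.

Lemma ps_inv_euler6 N :
  ps_inv euler6 N = #|[set f : occupation N | occ_level f == N]|%:R :> C.
Proof.
pose w (s : colour * 'I_N) := s.2.+1.
rewrite -[RHS](coef_prod_occupation (R := R) w).
set G := \prod_t _; apply: (ps_inv_unique (g := fun n => G`_n)).
  rewrite (euler6_coef (leq0n 0)) big_geq //= coef1; exact: oner_neq0.
move=> n nN; rewrite -(coef_prod_geometric (R := R) (w := w) _ nN) //.
have -> : \prod_t (1 - 'X^(w t)) =
    \prod_(1 <= n < N.+1) (1 - 'X^n) ^+ 6 :> {poly C}.
  rewrite -(pair_bigA _ (fun (x : colour) (m : 'I_N) => 1 - 'X^(m.+1))) /=.
  rewrite exchange_big /= big_add1 big_mkord; apply: eq_bigr => m _.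
  by rewrite prodr_const card_sum !card_ord.
rewrite coefMr -/G; apply: eq_bigr => k _; congr (_ * _).
by apply: euler6_coef; apply: leq_trans nN; apply: leq_subr.
Qed.

Definition level (l : seq mode) : nat := (\sum_(s <- l) s.2.+1)%N.

Definition modes_of N (f : occupation N) : seq mode :=
  flatten [seq nseq (f s) (s.1, nat_of_ord s.2) | s <- index_enum _].

Lemma count_modes_of N (f : occupation N) (s : mode) :
  count_mem s (modes_of f) = (\sum_t f t * ((t.1, nat_of_ord t.2) == s))%N.
Proof.
rewrite count_flatten sumnE !big_map; apply: eq_bigr => t _.
by rewrite count_nseq mulnC.
Qed.

Lemma count_modes_of_ord N (f : occupation N) (t : colour * 'I_N) :
  count_mem (t.1, nat_of_ord t.2) (modes_of f) = f t.
Proof.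
rewrite count_modes_of (bigD1 t) //= eqxx muln1 big1 ?addn0 // => u ut.
case: eqP => [[E1 E2]|]; last by rewrite muln0.
by case/eqP: ut; case: u t E1 E2 => [u1 u2] [t1 t2] /= -> /val_inj ->.
Qed.

Lemma level_modes_of N (f : occupation N) : level (modes_of f) = occ_level f.
Proof.
rewrite /level big_flatten big_map; apply: eq_bigr => t _.
by rewrite big_nseq iter_addn_0 mulnC.
Qed.

Lemma modes_of_perm_inj N (f g : occupation N) :
  perm_eq (modes_of f) (modes_of g) -> f = g.
Proof.
move=> /permP fg; apply/ffunP => t; apply: val_inj => /=.
by rewrite -[LHS]count_modes_of_ord fg count_modes_of_ord.
Qed.

Lemma mode_lt_level l (s : mode) : s \in l -> (s.2 < level l)%N.
Proof. by move=> sl; rewrite /level (big_rem s) //= leq_addr. Qed.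

Lemma size_le_level l : (size l <= level l)%N.
Proof.
by rewrite /level -sum1_size; apply: leq_sum.
Qed.

(** Together with [modes_of_perm_inj]: occupation numbers of level N are the
    multisets of modes of level N. *)
Lemma modes_of_surj (l : seq mode) :
  exists2 f : occupation (level l), occ_level f = level l &
    perm_eq (modes_of f) l.
Proof.
set N := level l.
pose f : occupation N := [ffun t => inord (count_mem (t.1, nat_of_ord t.2) l)].
have fP : perm_eq (modes_of f) l.
  apply/permP/permP; apply/allP => s _; apply/eqP.
  have [sN|Ns] := ltnP s.2 N.
    move: (count_modes_of_ord f (s.1, Ordinal sN)).
    rewrite ffunE /= -surjective_pairing => ->; rewrite inordK // ltnS.
    by apply: leq_trans (size_le_level l); apply: count_size.
  rewrite count_modes_of big1 => [|t _]; last first.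
    case: eqP => [E|]; last by rewrite muln0.
    by move: Ns; rewrite -E /= leqNgt ltn_ord.
  apply/esym/count_memPn/negP => /mode_lt_level; rewrite ltnNge.
  exact/negP/negPn.
exists f => //; rewrite -level_modes_of; exact: perm_big.
Qed.

End Counting.

(** * Monomials in the creation operators *)

Section Oscillators.
Context {R : realType}.
Local Notation C := R[i].
Variables (q : C) (V : lmodType C) (O : oscillators q V).
Hypotheses (hq0 : q != 0) (hq : forall n : nat, (0 < n)%N -> q ^+ n != 1).

Definition osc (x : colour) (n : int) : {linear V -> V} :=
  match x with inl j => osc_a O j n | inr l => osc_c O l n end.

Definition sgn (x : colour) : C :=
  match x with inl j => (-1) ^+ j | inr _ => 1 end.

Definition kappa (n : int) : C := qint q n ^+ 2 / n%:~R.

Definition zero_mode (la : 'rV[C]_4) (mu : 'rV[C]_2) (x : colour) : C :=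
  match x with inl j => la 0 j | inr l => mu 0 l end.

Lemma sgn_sq x : sgn x * sgn x = 1.
Proof. by case: x => j /=; rewrite ?mulr1 // -expr2 sqrr_sign. Qed.

Lemma osc_comm x y n m v :
  osc x n (osc y m v) - osc y m (osc x n v) =
  (if (x == y) && (m + n == 0) then sgn x * kappa n else 0) *: v.
Proof.
case: x y => [j|l] [j'|l'] /=.
- exact: osc_aa.
- by rewrite (osc_ac O) subrr scale0r.
- by rewrite (osc_ac O) subrr scale0r.
- by rewrite mul1r; exact: osc_cc.
Qed.

Lemma osc_exp x n la mu v :
  osc x n (osc_E O la mu v) = osc_E O la mu (osc x n v) +
  (if n == 0 then zero_mode la mu x else 0) *: osc_E O la mu v.
Proof.
apply/eqP; rewrite addrC -subr_eq; apply/eqP.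
by case: x => j /=; [exact: osc_aE | exact: osc_cE].
Qed.

Lemma osc_vacE x (m : nat) : osc x m (osc_vac O) = 0.
Proof. by case: x => j /=; [exact: osc_a_vac | exact: osc_c_vac]. Qed.

(** If q^n = q^(-n) then q^(2n) = 1. *)
Lemma qint_neq0 (m : nat) : qint q m.+1 != 0.
Proof.
have sub_inv_neq0 (n : nat) : q ^+ n.+1 - (q ^+ n.+1)^-1 != 0.
  have qn : q ^+ n.+1 != 0 by rewrite expf_neq0.
  rewrite subr_eq0; apply/eqP => E.
  have /eqP : q ^+ (n.+1 + n.+1) = 1 by rewrite exprD {2}E mulfV.
  by apply/negP/hq.
rewrite /qint -exprnN mulf_neq0 //; first exact: sub_inv_neq0.
by rewrite invr_eq0; have := sub_inv_neq0 0%N; rewrite expr1.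
Qed.

(** If q^n = - q^(-n) then q^(4n) = 1. *)
Lemma qsum_neq0 (m : nat) : q ^ m.+1%:Z + q ^ (- m.+1%:Z) != 0.
Proof.
have qn : q ^+ m.+1 != 0 by rewrite expf_neq0.
rewrite -exprnN -exprnP addr_eq0; apply/eqP => E.
have E2 : q ^+ (m.+1 + m.+1) = -1 by rewrite exprD {1}E mulNr mulVf.
have /eqP : q ^+ ((m.+1 + m.+1) * 2) = 1 by rewrite exprM E2 sqrrN expr1n.
by apply/negP/hq.
Qed.

Lemma kappa_neq0 (m : nat) : kappa m.+1 != 0.
Proof.
by rewrite mulf_neq0 ?expf_neq0 ?qint_neq0 // invr_eq0 intr_eq0.
Qed.

Definition cr (s : mode) : {linear V -> V} := osc s.1 (- (s.2.+1)%:Z).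
Definition an (s : mode) : {linear V -> V} := osc s.1 (s.2.+1)%:Z.
Definition nrm (s : mode) : C := sgn s.1 * kappa s.2.+1.

Lemma nrm_neq0 s : nrm s != 0.
Proof.
apply: mulf_neq0 (kappa_neq0 _); apply/eqP => s0.
by have := sgn_sq s.1; rewrite s0 mul0r => /esym/eqP; rewrite oner_eq0.
Qed.

Lemma crC s t v : cr s (cr t v) = cr t (cr s v).
Proof.
apply/eqP; rewrite -subr_eq0 osc_comm.
by rewrite -opprD oppr_eq0 andbF scale0r.
Qed.

Lemma an_cr s t v :
  an s (cr t v) = cr t (an s v) + (if s == t then nrm s else 0) *: v.
Proof.
apply/eqP; rewrite addrC -subr_eq osc_comm; case: s t => x m [y n] /=.
by rewrite xpair_eqE [_ + m.+1%:Z]addrC subr_eq0 eqz_nat eqSS.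
Qed.

Lemma osc0_cr x s v : osc x 0 (cr s v) = cr s (osc x 0 v).
Proof.
by apply/eqP; rewrite -subr_eq0 osc_comm addr0 oppr_eq0 andbF scale0r.
Qed.

Section Fock.
Variables (la : 'rV[C]_4) (mu : 'rV[C]_2).
Definition ket : V := osc_E O la mu (osc_vac O).
Definition mono (l : seq mode) : V := foldr (fun s v => cr s v) ket l.

Lemma ket_neq0 : ket != 0.
Proof.
apply/eqP => k0; have /negP := osc_vac_neq0 O; apply; apply/eqP.
rewrite -[LHS](osc_E0 O) -(subrr la) -(subrr mu) -(addrC (- la)) -(addrC (- mu)).
by rewrite -osc_ED -/ket k0 linear0.
Qed.

Lemma an_ket s : an s ket = 0.
Proof. by rewrite /an osc_exp osc_vacE linear0 add0r scale0r. Qed.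

Lemma osc0_mono x l : osc x 0 (mono l) = zero_mode la mu x *: mono l.
Proof.
elim: l => [|s l IHl] /=; last by rewrite osc0_cr IHl linearZ.
by rewrite /ket osc_exp (osc_vacE _ 0) linear0 add0r.
Qed.

Lemma cr_mono_rem s l : s \in l -> cr s (mono (rem s l)) = mono l.
Proof.
elim: l => //= t l IHl; rewrite inE eq_sym; have [-> //|st] := eqVneq t s.
by move=> /= sl; rewrite crC IHl.
Qed.

(** The creation operators commute. *)
Lemma mono_perm l1 l2 : perm_eq l1 l2 -> mono l1 = mono l2.
Proof.
elim: l1 l2 => [|s l1 IHl] l2.
  by rewrite perm_sym => /perm_nilP ->.
move=> sl; have sl2 : s \in l2 by rewrite -(perm_mem sl) mem_head.
rewrite -(cr_mono_rem sl2) /= (IHl (rem s l2)) // -(perm_cons s).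
by rewrite (perm_trans sl) // perm_to_rem.
Qed.

(** An annihilation operator acts on monomials as a derivation. *)
Lemma an_mono s l :
  an s (mono l) = ((count_mem s l)%:R * nrm s) *: mono (rem s l).
Proof.
elim: l => [|t l IHl] /=; first by rewrite an_ket mul0r scale0r.
rewrite an_cr IHl linearZ /= eq_sym; have [->|st] := eqVneq t s; last first.
  by rewrite scale0r addr0.
have [sl|/count_memPn ->] := boolP (s \in l).
  by rewrite (cr_mono_rem sl) -scalerDl -[X in _ + X]mul1r -mulrDl natr1 add1n.
by rewrite mul0r scale0r add0r mul1r.
Qed.

(** The candidates for dual functionals of the monomials. *)
Definition annih (l : seq mode) (v : V) : V := foldl (fun v s => an s v) v l.

Lemma annihZ l x v : annih l (x *: v) = x *: annih l v.
Proof. by elim: l v => //= s l IHl v; rewrite linearZ IHl. Qed.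

Lemma annih0 l : annih l 0 = 0.
Proof. by have := annihZ l 0 0; rewrite !scale0r. Qed.

Lemma annih_sum l (I : Type) (r : seq I) (v : I -> V) :
  annih l (\sum_(i <- r) v i) = \sum_(i <- r) annih l (v i).
Proof. by elim: l v => //= s l IHl v; rewrite linear_sum IHl. Qed.

(** Annihilating along l leaves a monomial in what remains of l'. The equality of
    levels excludes a nonempty remainder, so only permutations of l survive. *)
Lemma annih_mono l l' : level l = level l' ->
  exists2 c, c != 0 & annih l (mono l') = (if perm_eq l l' then c else 0) *: ket.
Proof.
elim: l l' => [|s l IHl] l' ll' /=.
  have -> : l' = [::].
    apply/size0nil/eqP; rewrite -leqn0 (leq_trans (size_le_level l')) //.
    by rewrite -ll' /level big_nil.
  by exists 1; rewrite ?oner_neq0 //= scale1r.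
rewrite an_mono; have [sl'|sl'] := boolP (s \in l'); last first.
  exists 1; rewrite ?oner_neq0 //; move: (sl') => /count_memPn ->.
  have -> : perm_eq (s :: l) l' = false.
    by apply: contraNF sl' => /perm_mem <-; rewrite mem_head.
  by rewrite mul0r annihZ !scale0r.
have ll : level l = level (rem s l').
  move: ll'; rewrite /level big_cons [RHS](big_rem s) //=; exact: addnI.
have [c c0 E] := IHl _ ll.
exists ((count_mem s l')%:R * nrm s * c).
  apply: mulf_neq0 c0; apply: mulf_neq0 (nrm_neq0 _).
  by rewrite pnatr_eq0 -lt0n -has_count has_pred1.
rewrite annihZ E scalerA.
rewrite (permPr (perm_to_rem sl')) perm_cons.
by case: ifP; rewrite ?mulr0.
Qed.

(** Annihilating along l i isolates the coefficient x i. *)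
Lemma mono_free N (I : finType) (l : I -> seq mode) (x : I -> C) :
    (forall i, level (l i) = N) ->
    (forall i j, perm_eq (l i) (l j) -> i = j) ->
  \sum_i x i *: mono (l i) = 0 -> forall i, x i = 0.
Proof.
move=> lN linj x0 i; have [c c0 E] := @annih_mono (l i) (l i) erefl.
have := congr1 (annih (l i)) x0; rewrite annih_sum annih0.
rewrite (bigD1 i) //= annihZ big1 => [|j ji].
  rewrite E perm_refl addr0 scalerA => /eqP; rewrite scaler_eq0 (negPf ket_neq0).
  by rewrite orbF mulf_eq0 (negPf c0) orbF => /eqP.
have [d d0] := @annih_mono (l i) (l j) (etrans (lN i) (esym (lN j))).
rewrite annihZ => ->; case: ifP => [/linj ij|]; last by rewrite scale0r scaler0.
by rewrite ij eqxx in ji.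
Qed.

End Fock.
End Oscillators.

(** * The Cartan matrix as a Gram matrix *)

Section Cartan.
Context {R : realType}.
Local Notation C := R[i].

(** Indices are written inord 0, ..., inord 3 so that inordK evaluates matrix
    entries given by lists. *)
Lemma sum4E (W : nmodType) (F : 'I_4 -> W) :
  \sum_i F i = F (inord 0) + F (inord 1) + F (inord 2) + F (inord 3).
Proof.
rewrite !big_ord_recl big_ord0 addr0 !addrA.
by congr (F _ + F _ + F _ + F _); apply: val_inj; rewrite /= inordK.
Qed.

Lemma ord4_ind (P : 'I_4 -> Prop) :
  P (inord 0) -> P (inord 1) -> P (inord 2) -> P (inord 3) -> forall i, P i.
Proof.
move=> P0 P1 P2 P3 i; rewrite -(inord_val i).
by case: i => [[|[|[|[|//]]]]].
Qed.

Lemma ord4_eq (i j : 'I_4) : (i == j) = (nat_of_ord i == nat_of_ord j).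
Proof. by []. Qed.

Definition amat_inv : 'M[C]_4 := \matrix_(i, j)
  (nth [::] [:: [:: 1/2;  1/2;    0; 1/4];
                [:: 1/2;    0; -1/2;   0];
                [::   0; -1/2; -1/2; 1/4];
                [:: 1/4;    0;  1/4;   0]] i)`_j.

(** The coordinates of A^1, A^2, A^3 and of A^4 without its factor
    (q^n + q^(-n)) / 2, in the a-bosons. *)
Definition cartan_coef : 'M[C]_4 := \matrix_(i, k)
  (nth [::] [:: [:: 1;  1;  0;  0];
                [:: 0; -1; -1;  0];
                [:: 0;  0;  1;  1];
                [:: 1; -1;  1; -1]] i)`_k.

Definition signs : 'M[C]_4 := \matrix_(i, j) ((-1) ^+ i *+ (i == j)).

Lemma mulmx_amat_inv : amat *m amat_inv = 1%:M.
Proof.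
apply/matrixP; elim/ord4_ind; elim/ord4_ind;
  rewrite !mxE sum4E !mxE ?ord4_eq !inordK //=; by field.
Qed.

Lemma ainvE : ainv = amat_inv :> 'M[C]_4.
Proof.
have [u _] := mulmx1_unit mulmx_amat_inv.
by rewrite /ainv -[RHS](mulKmx u) mulmx_amat_inv mulmx1.
Qed.

Lemma signs_sq : signs *m signs = 1%:M.
Proof.
apply/matrixP; elim/ord4_ind; elim/ord4_ind;
  rewrite !mxE sum4E !mxE ?ord4_eq !inordK //=; ring.
Qed.

Lemma amat_gram : amat = cartan_coef *m signs *m cartan_coef^T.
Proof.
apply/matrixP; elim/ord4_ind; elim/ord4_ind;
  rewrite !mxE sum4E !mxE !sum4E !mxE ?ord4_eq !inordK //=; ring.
Qed.

(** With G the coordinate matrix and D the form, amat = G D G^T, and D^2 = 1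
    turns G D G^T ainv = 1 into G^T ainv G = D. *)
Lemma cartan_casimir : cartan_coef^T *m ainv *m cartan_coef = signs.
Proof.
have := mulmx_amat_inv; rewrite -ainvE amat_gram -!mulmxA => /mulmx1C.
rewrite -!mulmxA => H.
by rewrite -[RHS]mulmx1 -H !mulmxA signs_sq mul1mx.
Qed.

End Cartan.

(** * The derivation in terms of oscillators *)

Section Energy.
Context {R : realType}.
Local Notation C := R[i].
Variables (q : C) (V : lmodType C) (O : oscillators q V).
Hypotheses (hq0 : q != 0) (hq : forall n : nat, (0 < n)%N -> q ^+ n != 1).

Definition curr (i : 'I_4) (n : int) (v : V) : V :=
  \sum_k cartan_coef i k *: osc_a O k n v.

Definition curr_scale (i : 'I_4) (n : int) : C :=
  if (i < 3)%N then 1 else (q ^ n + q ^ (- n)) / 2.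

Lemma opAE i n v : opA O i n v = curr_scale i n *: curr i n v.
Proof.
have sgn3 : (-1) ^+ 3 = -1 :> C by rewrite exprS sqrrN expr1n mulr1.
rewrite /opA /curr /curr_scale; elim/ord4_ind: i;
  rewrite !sum4E !mxE !inordK //= !(expr0, expr1, sqrrN, expr1n, sgn3);
  by rewrite !(scale0r, scale1r, scaleN1r, add0r, addr0, opprD).
Qed.

Fact curr_is_linear i n : linear (curr i n).
Proof.
move=> a u v; rewrite /curr scaler_sumr -big_split; apply: eq_bigr => k _ /=.
by rewrite linearP scalerDr !scalerA mulrC.
Qed.

HB.instance Definition _ i n :=
  GRing.isLinear.Build C V V _ (curr i n) (curr_is_linear i n).

(** The inverse Gram matrix gives the canonical element of the form, whatever
    basis of currents is used. *)
Lemma curr_casimir n m v :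
  \sum_i curr i n (\sum_l ainv i l *: curr l m v) =
  \sum_(k < 4) (-1) ^+ k *: osc_a O k n (osc_a O k m v).
Proof.
pose F (k j : 'I_4) := osc_a O k n (osc_a O j m v).
transitivity (\sum_k \sum_j (cartan_coef^T *m ainv *m cartan_coef) k j *: F k j).
  transitivity (\sum_i \sum_l \sum_k \sum_j
      (cartan_coef i k * ainv i l * cartan_coef l j) *: F k j).
    apply: eq_bigr => i _; rewrite linear_sum; apply: eq_bigr => l _.
    rewrite linearZ /= /curr scaler_sumr; apply: eq_bigr => k _.
    rewrite linear_sum /= !scaler_sumr; apply: eq_bigr => j _.
    rewrite [osc_a O k n _]linearZ /= !scalerA; congr (_ *: _); ring.
  under eq_bigr do rewrite exchange_big /=.
  rewrite exchange_big /=; apply: eq_bigr => k _.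
  under eq_bigr do rewrite exchange_big /=.
  rewrite exchange_big /=; apply: eq_bigr => j _.
  rewrite mxE scaler_suml exchange_big /=; apply: eq_bigr => l _.
  rewrite [(_ *m _) k l]mxE mulr_suml scaler_suml; apply: eq_bigr => i _.
  by rewrite [_^T _ _]mxE.
apply: eq_bigr => k _; rewrite cartan_casimir (bigD1 k) //= big1 ?addr0 => [|j jk].
  by rewrite mxE eqxx.
by rewrite mxE eq_sym (negPf jk) scale0r.
Qed.

Lemma opAs0 i v : opAs O i 0 v = \sum_l ainv i l *: curr l 0 v.
Proof.
rewrite /opAs eqxx; apply: eq_bigr => l _; rewrite opAE /curr_scale oppr0 expr0z.
by rewrite -[1 + 1]/2 divff ?if_same ?scale1r // pnatr_eq0.
Qed.

Lemma ainv33 : ainv (inord 3) (inord 3) = 0 :> C.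
Proof. by rewrite ainvE mxE !inordK. Qed.

Lemma ord_max3 : ord_max = inord 3 :> 'I_4.
Proof. by apply: val_inj; rewrite /= inordK. Qed.

(** For i < 3 the factor 2 / (q^n + q^(-n)) undoes the normalization of A^4. For
    the last current, A^4 itself would enter with that factor, but the
    corresponding entry of ainv vanishes. *)
Lemma opAs_pos i (m : nat) v : (0 < m)%N ->
  opAs O i m v = (if (i < 3)%N then 1 else 4) *: \sum_l ainv i l *: curr l m v.
Proof.
case: m => // m _.
have qs := qsum_neq0 hq0 hq m.
rewrite /opAs -[_ == 0]/false; case: ifP => i3; last first.
  have -> : i = inord 3.
    by apply: val_inj; rewrite /= inordK //; case: i i3 => [[|[|[|[|]]]]].
  rewrite !sum4E !opAE /curr_scale !inordK //= !scale1r ainv33.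
  by rewrite !scale0r.
rewrite scale1r big_mkcond !sum4E ord_max3 !opAE /curr_scale !inordK //=.
rewrite addr0 !scale1r; congr (_ + _); rewrite scalerA; congr (_ *: _).
by field; rewrite qs.
Qed.

(** For m > 0 this is a multiple of the number operator of frequency m. *)
Definition quad (m : int) (v : V) : V :=
  \sum_(x : colour) sgn x *: osc O x (- m) (osc O x m v).

Lemma quadE m v : quad m v =
  \sum_(k < 4) (-1) ^+ k *: osc_a O k (- m) (osc_a O k m v)
  + \sum_l osc_c O l (- m) (osc_c O l m v).
Proof.
rewrite /quad big_sumType /=; congr (_ + _).
by apply: eq_bigr => l _; rewrite scale1r.
Qed.

Lemma bracket_pos (m : nat) v : (0 < m)%N ->
  \sum_(i < 4 | (i < 3)%N) opA O i (- m%:Z) (opAs O i m v)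
  + (1 / (2 * (q ^ m%:Z + q ^ (- m%:Z)))) *:
      opA O ord_max (- m%:Z) (opAs O ord_max m v)
  + \sum_(l < 2) osc_c O l (- m%:Z) (osc_c O l m v) = quad m v.
Proof.
move=> m0; rewrite quadE -curr_casimir; congr (_ + _).
rewrite big_mkcond !sum4E ord_max3 !opAE !opAs_pos // /curr_scale !inordK //=.
rewrite addr0 !scale1r; congr (_ + _); first by rewrite !sum4E.
rewrite !sum4E [curr _ _ (_ *: _)]linearZ /= !scalerA.
case: m m0 => // m _; have qs := qsum_neq0 hq0 hq m.
rewrite -[RHS]scale1r; congr (_ *: _); rewrite opprK [q ^ (- _) + _]addrC.
by field; rewrite qs.
Qed.

Definition zero_energy (v : V) : V :=
  quad 0 v + \sum_(l < 2) osc_c O l 0 v.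

Lemma bracket_zero v :
  \sum_(i < 4) opA O i 0 (opAs O i 0 v)
  + \sum_(l < 2) osc_c O l 0 (osc_c O l 0 v + v) = zero_energy v.
Proof.
rewrite /zero_energy quadE oppr0 -addrA -big_split /= -curr_casimir.
congr (_ + _); last by apply: eq_bigr => l _; rewrite linearD.
apply: eq_bigr => i _; rewrite opAs0 opAE /curr_scale oppr0 expr0z.
by rewrite -[1 + 1]/2 divff ?if_same ?scale1r // pnatr_eq0.
Qed.

(** The sum over all m in opd is only meaningful where it is finite, so opd need
    not be linear on V. Its truncations are, and they agree with - opd on vectors of
    bounded level. *)
Definition opd_trunc (M : nat) (v : V) : V :=
  \sum_(m < M) (m.+1%:R ^+ 2 / qint q m.+1 ^+ 2) *: quad m.+1 v
  + (1 / 2) *: zero_energy v.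

Lemma opd_truncE M v : (forall m, (M <= m)%N -> quad m.+1 v = 0) ->
  - opd O v = opd_trunc M v.
Proof.
move=> vM; rewrite /opd /opd_trunc bracket_zero opprB opprK addrC; congr (_ + _).
rewrite (fsbigE (iota 1 M)) ?iota_uniq //=; first last.
- move=> m /= m0; rewrite mem_iota m0 /= add1n ltnS -ltnNge => Mm.
  by rewrite bracket_pos // -(prednK m0) vM ?scaler0 // -ltnS prednK.
- by move=> m /=; rewrite mem_iota => /andP[].
rewrite (iotaDl 1 0 M) big_map -[M in iota 0 M]subn0 big_mkcond big_mkord.
apply: eq_bigr => m _; rewrite add1n ifT; first by rewrite bracket_pos.
exact/mem_set.
Qed.

Fact quad_is_linear m : linear (quad m).
Proof.
move=> a u v; rewrite /quad scaler_sumr -big_split; apply: eq_bigr => x _ /=.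
by rewrite !linearP.
Qed.

HB.instance Definition _ m :=
  GRing.isLinear.Build C V V _ (quad m) (quad_is_linear m).

Fact zero_energy_is_linear : linear zero_energy.
Proof.
move=> a u v; rewrite /zero_energy linearP scalerDr addrACA; congr (_ + _).
rewrite scaler_sumr -big_split; apply: eq_bigr => l _ /=; exact: linearP.
Qed.

HB.instance Definition _ :=
  GRing.isLinear.Build C V V _ zero_energy zero_energy_is_linear.

Fact opd_trunc_is_linear M : linear (opd_trunc M).
Proof.
move=> a u v; rewrite /opd_trunc linearP scalerDr [a *: (_ + _)]scalerDr addrACA.
rewrite [(1 / 2) *: _]scalerA [a *: (_ *: _)]scalerA mulrC. congr (_ + _).
rewrite scaler_sumr -big_split; apply: eq_bigr => m _ /=.
by rewrite linearP scalerDr !scalerA mulrC.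
Qed.

HB.instance Definition _ M :=
  GRing.isLinear.Build C V V _ (opd_trunc M) (opd_trunc_is_linear M).

Section Fock.
Variables (la : 'rV[C]_4) (mu : 'rV[C]_2).

(** The signs of the a-bosons cancel: one from quad, one from the commutator. *)
Lemma quad_mono (m : nat) l : quad m.+1 (mono O la mu l) =
  ((count (fun s : mode => s.2 == m) l)%:R * kappa q m.+1) *: mono O la mu l.
Proof.
transitivity (\sum_(x : colour)
    ((count_mem ((x, m) : mode) l)%:R * kappa q m.+1) *: mono O la mu l).
  apply: eq_bigr => x _; have := an_mono O la mu (x, m) l; rewrite /an /= => ->.
  have [xl|/count_memPn ->] := boolP ((x, m) \in l); last first.
    by rewrite !mul0r !scale0r linear0 scaler0.
  have := cr_mono_rem O la mu xl; rewrite /cr /= => E.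
  rewrite linearZ /= E scalerA /nrm /=; congr (_ *: _).
  by rewrite mulrCA; congr (_ * _); rewrite mulrA sgn_sq mul1r.
rewrite -scaler_suml -mulr_suml -natr_sum; congr ((_%:R * _) *: _).
elim: l => [|s l IHl] /=; first by rewrite big1.
rewrite -IHl big_split /=; congr (_ + _)%N.
case: s => y n; rewrite /= (bigD1 y) //= xpair_eqE eqxx /= big1 ?addn0 // => x xy.
by rewrite xpair_eqE eq_sym (negPf xy).
Qed.

Lemma zero_energy_mono l : zero_energy (mono O la mu l) =
  (\sum_(j < 4) (-1) ^+ j * la 0 j ^+ 2
   + \sum_(i < 2) mu 0 i * (mu 0 i + 1)) *: mono O la mu l.
Proof.
have aE j := osc0_mono O la mu (inl j) l.
have cE j := osc0_mono O la mu (inr j) l.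
rewrite /= in aE cE.
rewrite /zero_energy quadE oppr0 -addrA -big_split /= scalerDl !scaler_suml.
congr (_ + _); apply: eq_bigr => j _.
  by rewrite aE [osc_a O j 0 _]linearZ /= aE !scalerA expr2 mulrA.
by rewrite cE linearZ /= cE scalerA mulrDr mulr1 scalerDl.
Qed.

Lemma sum_count_level l M : (level l <= M)%N ->
  (\sum_(m < M) m.+1 * count (fun s : mode => s.2 == m :> nat) l)%N = level l.
Proof.
rewrite /level; elim: l => [|s l IHl] /=.
  by rewrite big_nil => _; apply: big1 => m _; rewrite muln0.
rewrite big_cons => lM; have sM : (s.2 < M)%N by exact: leq_trans (leq_addr _ _) lM.
under eq_bigr do rewrite mulnDr.
rewrite big_split /= IHl ?(leq_trans (leq_addl _ _) lM) //; congr (_ + _)%N.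
rewrite (bigD1 (Ordinal sM)) //= eqxx muln1 big1 ?addn0 // => m ms.
by case: eqP => [E|]; rewrite ?muln0 //; case/eqP: ms; apply: val_inj.
Qed.

Lemma quad_mono0 (m : nat) l : (level l <= m)%N -> quad m.+1 (mono O la mu l) = 0.
Proof.
move=> lm; rewrite quad_mono (_ : count _ l = 0%N) ?mul0r ?scale0r //.
apply/eqP; rewrite -leqn0 leqNgt -has_count; apply/hasPn => s /mode_lt_level sl.
by rewrite neq_ltn (leq_trans sl).
Qed.

Lemma opd_trunc_mono M l : (level l <= M)%N ->
  opd_trunc M (mono O la mu l) =
  ((level l)%:R + (\sum_(j < 4) (-1) ^+ j * la 0 j ^+ 2
   + \sum_(i < 2) mu 0 i * (mu 0 i + 1)) / 2) *: mono O la mu l.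
Proof.
move=> lM; rewrite /opd_trunc zero_energy_mono scalerA [RHS]scalerDl.
rewrite [1 / 2 * _]mulrC mul1r; congr (_ + _).
rewrite -(sum_count_level lM) natr_sum scaler_suml; apply: eq_bigr => m _.
rewrite quad_mono scalerA natrM; congr (_ *: _); rewrite /kappa.
have m0 : m.+1%:R != 0 :> C by rewrite pnatr_eq0.
have q0 := qint_neq0 hq0 hq m; rewrite -pmulrn.
move: (qint _ _) (m.+1%:R : C) q0 m0 => a b a0 b0.
by field; rewrite a0 b0.
Qed.

End Fock.
End Energy.

(** * Projecting onto joint eigenspaces *)

Section EigenProjection.
Variables (K : fieldType) (V : lmodType K) (T : {linear V -> V}).
Variables (I : eqType) (w : I -> K).

(** Applying T - w j removes the j-th term and multiplies the eigenvector u by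
    the nonzero scalar c - w j. *)
Lemma eigen_sum_eq0 (r : seq I) (v : I -> V) (c : K) (u : V) :
    {in r, forall i, T (v i) = w i *: v i} -> {in r, forall i, w i != c} ->
    u = \sum_(i <- r) v i -> T u = c *: u ->
  u = 0.
Proof.
elim: r v c u => [|j r IHr] v c _ Tv wc ->; first by rewrite big_nil.
set u' := \sum_(i <- _) _ => Tu.
have jr : j \in j :: r by rewrite mem_head.
have sr i : i \in r -> i \in j :: r by rewrite inE orbC => ->.
have cw : c - w j != 0 by rewrite subr_eq0 eq_sym wc.
apply: (IHr (fun i => ((w i - w j) / (c - w j)) *: v i) c u') => //.
- by move=> i /sr ir; rewrite linearZ /= Tv // !scalerA mulrC.
- by move=> i /sr ir; rewrite wc.
apply: (scalerI cw); rewrite [LHS]scalerBl -Tu /u' linear_sum !scaler_sumr -sumrB.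
rewrite big_cons Tv // subrr add0r big_seq [RHS]big_seq.
apply: eq_bigr => i /sr ir; rewrite Tv // -scalerBl scalerA mulrC divfK //.
Qed.

(** An eigenvector written as a sum of eigenvectors only involves those of its
    own eigenvalue. *)
Lemma eigen_filter (r : seq I) (v : I -> V) (c : K) (u : V) :
    {in r, forall i, T (v i) = w i *: v i} ->
    u = \sum_(i <- r) v i -> T u = c *: u ->
  u = \sum_(i <- [seq i <- r | w i == c]) v i.
Proof.
move=> Tv uE Tu; apply/eqP; rewrite -subr_eq0; apply/eqP.
apply: (@eigen_sum_eq0 [seq i <- r | w i != c] v c).
- by move=> i; rewrite mem_filter => /andP[_ /Tv].
- by move=> i; rewrite mem_filter => /andP[].
- rewrite !big_filter uE [X in X - _](bigID (fun i => w i == c)) /=.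
  by rewrite [LHS]addrC addKr.
rewrite linearB /= Tu scalerBr; congr (_ - _).
rewrite linear_sum scaler_sumr big_seq [RHS]big_seq; apply: eq_bigr => i.
by rewrite mem_filter => /andP[/eqP <- /Tv].
Qed.

End EigenProjection.

(** * Powers of minus one *)

Section BranchOfMinusOne.
Context {R : realType}.

Lemma m1powD (x y : R[i]) : m1pow (x + y) = m1pow x * m1pow y.
Proof.
case: x y => [a b] [c d]; rewrite /m1pow /= !mulrDr opprD expRD cosD sinD.
by apply/eqP; rewrite eq_complex /=; apply/andP; split; apply/eqP; ring.
Qed.

Lemma m1pow_even (n : int) : m1pow (2 * n%:~R) = 1 :> R[i].
Proof.
have m0 : m1pow 0 = 1 :> R[i].
  transitivity (m1pow (Complex (0 : R) 0)); first by [].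
  by rewrite /m1pow /= mulr0 oppr0 expR0 cos0 sin0 mulr1 mulr0.
have m1 : m1pow (Complex 1 0) = - 1 :> R[i].
  rewrite /m1pow /= mulr0 oppr0 expR0 mulr1 cospi sinpi !mul1r.
  by apply/eqP; rewrite eq_complex /= oppr0 !eqxx.
have m2 : m1pow 2 = 1 :> R[i].
  by rewrite -[2]/(Complex 1 0 + Complex 1 0) m1powD m1 mulrNN mulr1.
have mnat (k : nat) : m1pow (2 * k%:R) = 1 :> R[i].
  elim: k => [|k IHk]; first by rewrite mulr0.
  by rewrite [k.+1%:R]mulrSr mulrDr mulr1 m1powD IHk m2 mulr1.
case: n => n; first exact: mnat.
have := m0; rewrite NegzE mulrNz mulrN -(subrr (2 * n.+1%:R)) m1powD mnat.
by rewrite mul1r.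
Qed.

End BranchOfMinusOne.

(** * Weight spaces of the module and its character *)

Section Character.
Context {R : realType}.
Local Notation C := R[i].
Variables (q : C) (V : lmodType C) (O : oscillators q V) (alpha beta : C).
Hypotheses (hq0 : q != 0) (hq : forall n : nat, (0 < n)%N -> q ^+ n != 1).

Definition sector : choiceType := (int * int * int)%type.

Definition la (p : sector) := lambda_a alpha beta p.1.1 p.1.2 p.2.
Definition mu (p : sector) := lambda_c alpha p.1.1 p.1.2 p.2.

Definition expo_q (i j k : int) : C :=
  (i ^+ 2 + j ^+ 2 + k ^+ 2 - 2 * k * j + i + j + k)%:~R / 2.

Definition expo_x (i j k : int) : 'rV[C]_4 :=
  \row_s [:: alpha + j%:~R;
             1 - alpha + i%:~R - k%:~R;
             - j%:~R;
             4 * beta + 2 - alpha + 2 * i%:~R - 2 * j%:~R + 2 * k%:~R]`_s.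

Definition ch_series (sg : int -> int -> int -> C) : fseries :=
  fs_qpow (alpha * (2 * beta + 1) / 2)
    (fs_mulq (ps_inv euler6) (fs_sumZ3 sg expo_q expo_x)).

Definition energy (p : sector) (N : nat) : C :=
  alpha * (2 * beta + 1) / 2 + expo_q p.1.1 p.1.2 p.2 + N%:R.

Definition charge (p : sector) : 'rV[C]_4 := expo_x p.1.1 p.1.2 p.2.

(** The charges of h_1, h_2 and h_4 determine j, i - k and i + k in turn. *)
Lemma charge_inj : injective charge.
Proof.
move=> [[i j] k] [[i' j'] k'] E.
have entry s := congr1 (fun m : 'rV_4 => m 0 s) E.
have E0 : alpha + j%:~R = alpha + j'%:~R.
  by have := entry (inord 0); rewrite !mxE !inordK.
have E1 : 1 - alpha + i%:~R - k%:~R = 1 - alpha + i'%:~R - k'%:~R.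
  by have := entry (inord 1); rewrite !mxE !inordK.
have E3 : 4 * beta + 2 - alpha + 2 * i%:~R - 2 * j%:~R + 2 * k%:~R =
    4 * beta + 2 - alpha + 2 * i'%:~R - 2 * j'%:~R + 2 * k'%:~R.
  by have := entry (inord 3); rewrite !mxE !inordK.
have jj : j = j' by apply: (@intr_inj C); apply: addrI E0.
rewrite {}jj {j E E0 entry} in E3 *.
have ik : i - k = i' - k'.
  apply: (@intr_inj C); rewrite !intrB; apply: (addrI (1 - alpha)).
  by rewrite !addrA.
have iks : i + k = i' + k'.
  apply: (@intr_inj C); apply/eqP; rewrite -subr_eq0 !intrD; apply/eqP.
  transitivity (((4 * beta + 2 - alpha + 2 * i%:~R - 2 * j'%:~R + 2 * k%:~R) -
    (4 * beta + 2 - alpha + 2 * i'%:~R - 2 * j'%:~R + 2 * k'%:~R)) / 2 : C).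
    by field.
  by rewrite E3 subrr mul0r.
by congr (_, _, _); lia.
Qed.

Lemma energy_inj p : injective (energy p).
Proof. by move=> N N' /addrI/eqP; rewrite eqr_nat => /eqP. Qed.

Lemma fs_sumZ3_charge sg e p :
  fs_sumZ3 sg expo_q expo_x e (charge p) =
  if e == expo_q p.1.1 p.1.2 p.2 then sg p.1.1 p.1.2 p.2 else 0.
Proof.
rewrite /fs_sumZ3; case: eqP => [->|ne].
  rewrite (_ : [set _ | _]%classic = [set p]%classic) ?fsbig_set1 //.
  by apply/seteqP; split=> p' /= => [[_ /charge_inj]|->].
rewrite (_ : [set _ | _]%classic = set0) ?fsbig_set0 //.
apply/seteqP; split=> // p' /= [E /charge_inj E']; apply: ne.
by rewrite -E E'.
Qed.

Lemma ch_series_in sg p N :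
  ch_series sg (energy p N) (charge p) = ps_inv euler6 N * sg p.1.1 p.1.2 p.2.
Proof.
rewrite /ch_series /fs_qpow /fs_mulq (fsbigE [:: N]) //=; last first.
  move=> N' _; rewrite inE => /eqP NN'; rewrite fs_sumZ3_charge.
  case: eqP => [E|_]; last by rewrite mulr0.
  case: NN'; apply: (@energy_inj p); rewrite [LHS]/energy -E; ring.
rewrite big_cons big_nil mem_setT addr0 fs_sumZ3_charge.
by rewrite (_ : (_ == _) = true) //; apply/eqP; rewrite /energy; ring.
Qed.

Lemma ch_series_out sg e m :
  (forall p N, ~ (energy p N = e /\ charge p = m)) -> ch_series sg e m = 0.
Proof.
move=> no; rewrite /ch_series /fs_qpow /fs_mulq fsbig1 // => N _.
rewrite /fs_sumZ3 (_ : [set _ | _]%classic = set0) ?fsbig_set0 ?mulr0 //.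
apply/seteqP; split=> // p /= [E Em]; apply: (no p N); split => //.
by rewrite /energy E; ring.
Qed.

Definition vec (p : sector) (l : seq mode) : V := mono O (la p) (mu p) l.

(** The terms in alpha^2, alpha i, alpha j and i j that come from the a-bosons
    cancel against those from c^1. *)
Lemma opd_trunc_vec M p l : (level l <= M)%N ->
  opd_trunc O M (vec p l) = energy p (level l) *: vec p l.
Proof.
move=> lM; rewrite /vec opd_trunc_mono //; congr (_ *: _).
have sgn3 : (-1) ^+ 3 = -1 :> C by rewrite exprS sqrrN expr1n mulr1.
case: p => [[i j] k].
rewrite sum4E !big_ord_recl big_ord0 !mxE !inordK //=.
rewrite sgn3 sqrrN expr1n expr0 expr1.
rewrite /energy /expo_q /=.
by field.
Qed.

Lemma oph_curr j v : oph O j v = curr O j 0 v.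
Proof.
rewrite /oph opAE /curr_scale oppr0 expr0z.
by rewrite -[1 + 1]/2 divff ?if_same ?scale1r // pnatr_eq0.
Qed.

Lemma oph_vec j p l : oph O j (vec p l) = charge p 0 j *: vec p l.
Proof.
have aE i : osc_a O i 0 (vec p l) = la p 0 i *: vec p l.
  exact: (osc0_mono O (la p) (mu p) (inl i) l).
rewrite oph_curr /curr.
under eq_bigr do rewrite aE scalerA.
rewrite -scaler_suml; congr (_ *: _); case: p {aE} => [[a b] c].
by rewrite sum4E; elim/ord4_ind: j; rewrite !mxE !inordK //=; ring.
Qed.

Lemma opNf_vec p l : opNf O (vec p l) =
  (alpha - 1 - 2 * beta - p.1.1%:~R + p.1.2%:~R - p.2%:~R) *: vec p l.
Proof.
have aE i : osc_a O i 0 (vec p l) = la p 0 i *: vec p l.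
  exact: (osc0_mono O (la p) (mu p) (inl i) l).
rewrite /opNf !aE -scalerDl; congr (_ *: _).
by rewrite !mxE !inordK //=; ring.
Qed.

Definition comb (ts : seq (C * (sector * seq mode))) : V :=
  \sum_(t <- ts) t.1 *: vec t.2.1 t.2.2.

Lemma fock_comb p v : fock O (la p) (mu p) v -> exists ts, v = comb ts.
Proof.
move=> F.
suff [ts ->] : exists ts : seq (C * seq mode),
    v = \sum_(t <- ts) t.1 *: vec p t.2.
  by exists [seq (t.1, (p, t.2)) | t <- ts]; rewrite /comb big_map.
have crV (s : mode) (ts : seq (C * seq mode)) :
    cr O s (\sum_(t <- ts) t.1 *: vec p t.2) =
    \sum_(t <- [seq (t.1, s :: t.2) | t <- ts]) t.1 *: vec p t.2.
  by rewrite linear_sum big_map; apply: eq_bigr => t _; rewrite linearZ.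
elim: F => [|j m w m0 _ [ts ->]|l m w m0 _ [ts ->]||x u w _ [ts ->] _ [ts' ->]].
- by exists [:: (1, [::])]; rewrite big_seq1 scale1r.
- by rewrite -(prednK m0) (crV (inl j, m.-1)); eexists.
- by rewrite -(prednK m0) (crV (inr l, m.-1)); eexists.
- by exists [::]; rewrite big_nil.
exists ([seq (x * t.1, t.2) | t <- ts] ++ ts').
rewrite big_cat big_map scaler_sumr; congr (_ + _).
by apply: eq_bigr => t _; rewrite scalerA.
Qed.

Lemma calF_comb v : calF O alpha beta v -> exists ts, v = comb ts.
Proof.
elim=> [i j k w F|u w _ [ts ->] _ [ts' ->]]; last first.
  by exists (ts ++ ts'); rewrite /comb big_cat.
exact: (@fock_comb (i, j, k)).
Qed.

Lemma vec_fock p l : fock O (la p) (mu p) (vec p l).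
Proof.
elim: l => [|[[j|j] m] l IHl]; first exact: fock_ket.
- exact: (@fock_a _ _ _ O _ _ j m.+1).
- exact: (@fock_c _ _ _ O _ _ j m.+1).
Qed.

Lemma fock_sum p (I : Type) (r : seq I) (x : I -> C) (l : I -> seq mode) :
  fock O (la p) (mu p) (\sum_(i <- r) x i *: vec p (l i)).
Proof.
elim: r => [|i r IHr]; first by rewrite big_nil; exact: fock_zero.
by rewrite big_cons; apply: fock_lin (vec_fock _ _) IHr.
Qed.

Lemma opd_comb M ts :
    {in ts, forall t : C * (sector * seq mode), (level t.2.2 <= M)%N} ->
  - opd O (comb ts) = opd_trunc O M (comb ts).
Proof.
move=> tM; apply: opd_truncE => // m Mm; rewrite /comb linear_sum big_seq big1 //.
move=> t /tM tl; rewrite linearZ /= quad_mono0 ?scaler0 //.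
exact: leq_trans Mm.
Qed.

(** A weight vector is a combination of monomials of its own weight: project with
    d, then with each of the h_j. *)
Lemma weight_space_comb e m v :
    weight_space (calF O alpha beta) (opd O) (oph O) e m v ->
  exists2 ts, v = comb ts &
    {in ts, forall t : C * (sector * seq mode),
       energy t.2.1 (level t.2.2) = e /\ charge t.2.1 = m}.
Proof.
move=> [/calF_comb[ts vE] dv hv].
pose term (t : C * (sector * seq mode)) := t.1 *: vec t.2.1 t.2.2.
pose M := (\max_(t <- ts) level t.2.2)%N.
have tM : {in ts, forall t : C * (sector * seq mode), (level t.2.2 <= M)%N}.
  by move=> t tts; apply: leq_bigmax_seq.
pose ts0 := [seq t <- ts | energy t.2.1 (level t.2.2) == e].
have vE0 : v = comb ts0.
  apply: (eigen_filter (T := opd_trunc O M) (v := term) _ vE) => [t tts|].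
    by rewrite linearZ /= opd_trunc_vec ?tM // !scalerA mulrC.
  by rewrite -dv vE (opd_comb tM).
have sel (s : seq 'I_4) : exists2 ts', v = comb ts' & {subset ts' <= ts0} /\
    {in ts', forall t : C * (sector * seq mode),
      {in s, forall j, charge t.2.1 0 j = m 0 j}}.
  elim: s => [|j s [ts' vE' [sub tm]]]; first by exists ts0 => //; split.
  exists [seq t <- ts' | charge t.2.1 0 j == m 0 j].
    apply: (eigen_filter (T := curr O j 0) (v := term) _ vE') => [t _|].
      by rewrite linearZ /= -oph_curr oph_vec !scalerA mulrC.
    by rewrite /= -oph_curr.
  split=> [t|t]; rewrite mem_filter => /andP[tj tts']; first exact: sub.
  by move=> j'; rewrite inE => /predU1P[->|js]; [exact/eqP|exact: tm].
have [ts' vE' [sub tm]] := sel (enum 'I_4).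
exists ts' => // t tts'; split.
  by have := sub t tts'; rewrite mem_filter => /andP[/eqP].
by apply/rowP => j; rewrite tm // mem_enum.
Qed.

Definition basis p N (s : 'I_#|[set f : occupation N | occ_level f == N]|) : V :=
  vec p (modes_of (enum_val s)).
Arguments basis : clear implicits.

Lemma level_basis N (s : 'I_#|[set f : occupation N | occ_level f == N]|) :
  level (modes_of (enum_val s)) = N.
Proof. by have := enum_valP s; rewrite inE level_modes_of => /eqP. Qed.

Lemma basis_free p N x : \sum_s x s *: basis p N s = 0 -> forall s, x s = 0.
Proof.
apply: (mono_free hq0 hq (N := N)) => [s|s t /modes_of_perm_inj/enum_val_inj //].
exact: level_basis.
Qed.

Lemma vec_basis p l : exists s, vec p l = basis p (level l) s.
Proof.
have [f fl fP] := modes_of_surj l.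
have fA : f \in [set f : occupation (level l) | occ_level f == level l].
  by rewrite inE fl.
exists (enum_rank_in fA f); rewrite /basis enum_rankK_in //.
by apply: mono_perm; rewrite perm_sym.
Qed.

Lemma comb_basis p N ts :
    {in ts, forall t : C * (sector * seq mode), t.2.1 = p /\ level t.2.2 = N} ->
  exists x, comb ts = \sum_s x s *: basis p N s.
Proof.
elim: ts => [|[c [p' l]] ts IHts] tP.
  by exists (fun _ => 0); rewrite /comb big_nil big1 // => s _; rewrite scale0r.
have [/= pp lN] := tP _ (mem_head _ _).
have [x xE] : exists x, comb ts = \sum_s x s *: basis p N s.
  by apply: IHts => t tts; apply: tP; rewrite inE tts orbT.
rewrite /comb big_cons -/(comb ts) xE /= {}pp; subst N.
have [s ->] := vec_basis p l.
exists (fun t => (if t == s then c else 0) + x t).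
under [RHS]eq_bigr do rewrite scalerDl.
rewrite big_split /=; congr (_ + _); rewrite (bigD1 s) //= eqxx big1 ?addr0 //.
by move=> t /negPf ->; rewrite scale0r.
Qed.

Lemma weight_space_basis p N v :
  weight_space (calF O alpha beta) (opd O) (oph O) (energy p N) (charge p) v <->
  exists x, v = \sum_s x s *: basis p N s.
Proof.
split=> [/weight_space_comb[ts -> tP]|[x ->]].
  apply: comb_basis => t /tP[tN /charge_inj tp]; split=> //.
  by move: tN; rewrite tp => /energy_inj.
split.
- exact/calF_fock/(fock_sum p).
- pose ts := [seq (x s, (p, modes_of (enum_val s))) | s <- index_enum _].
  have -> : \sum_s x s *: basis p N s = comb ts by rewrite /comb big_map.
  rewrite (@opd_comb N) => [|t /mapP[s _ ->]]; last by rewrite /= level_basis.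
  rewrite linear_sum scaler_sumr big_map [RHS]big_map; apply: eq_bigr => s _.
  by rewrite linearZ /= opd_trunc_vec level_basis // !scalerA mulrC.
- move=> j; rewrite oph_curr linear_sum scaler_sumr; apply: eq_bigr => s _.
  by rewrite linearZ /= -oph_curr oph_vec !scalerA mulrC.
Qed.

(** T only needs to be a scalar on each Fock space, which covers both the identity
    and N_f. *)
Lemma formal_trace_calF (f : C -> C) (T : V -> V) (nu : sector -> C)
    (sg : int -> int -> int -> C) :
    (forall p l, T (vec p l) = nu p *: vec p l) ->
    (forall p, f (nu p) = sg p.1.1 p.1.2 p.2) ->
  formal_trace (calF O alpha beta) f T (opd O) (oph O) (ch_series sg).
Proof.
move=> Tv fnu; split=> [v /calF_comb[ts ->]|e m].
  exists (size ts), (fun s => (tnth (in_tuple ts) s).1 *: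
    vec (tnth (in_tuple ts) s).2.1 (tnth (in_tuple ts) s).2.2).
  split; last by rewrite /comb big_tnth.
  move=> s; case: (tnth _ s) => c [p l] /=.
  exists (energy p (level l)), (charge p); apply/weight_space_basis.
  have [|x xE] := @comb_basis p (level l) [:: (c, (p, l))].
    by move=> t; rewrite inE => /eqP ->.
  by exists x; rewrite -xE /comb big_seq1.
have [[p [N [<- <-]]]|no] := pselect (exists p N, energy p N = e /\ charge p = m).
  exists #|[set f : occupation N | occ_level f == N]|, (basis p N), (fun _ => nu p).
  split.
  - exact: basis_free.
  - exact: weight_space_basis.
  - by move=> s; exact: Tv.
  - by rewrite ch_series_in ps_inv_euler6 sumr_const card_ord mulr_natl fnu.
(* A weight that no monomial has: the weight space is 0. *)
exists 0%N, (fun _ => 0), (fun _ => 0); split.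
- by move=> x _ [].
- move=> v; split=> [W|[x ->]].
    have [ts vE tP] := weight_space_comb W; exists (fun _ => 0); rewrite big_ord0 vE.
    rewrite /comb; case: ts tP {vE} => [|t ts] tP; first by rewrite big_nil.
    by case: no; exists t.2.1, (level t.2.2); apply: tP; rewrite mem_head.
  rewrite big_ord0; split; first exact/(@calF_fock _ _ _ O _ _ 0 0 0)/fock_zero.
    have := @opd_comb 0%N [::]; rewrite /comb big_nil => ->//.
    by rewrite linear0 scaler0.
  by move=> j; rewrite oph_curr linear0 scaler0.
- by case.
rewrite big_ord0; apply: ch_series_out => p N E; by apply: no; exists p, N.
Qed.

End Character.

Theorem proposition4 (R : realType) (q : R[i])
    (hq0 : q != 0) (hq : forall n : nat, (0 < n)%N -> q ^+ n != 1)
    (V : lmodType R[i]) (O : oscillators q V)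
    (alpha beta : R[i]) (halpha : forall n : int, alpha != n%:~R) :
  let expo_q (i j k : int) : R[i] :=
    (i ^+ 2 + j ^+ 2 + k ^+ 2 - 2 * k * j + i + j + k)%:~R / 2 in
  let expo_x (i j k : int) : 'rV[R[i]]_4 :=
    \row_s [:: alpha + j%:~R;
               1 - alpha + i%:~R - k%:~R;
               - j%:~R;
               4 * beta + 2 - alpha + 2 * i%:~R - 2 * j%:~R + 2 * k%:~R]`_s in
  let rhs (sgn : int -> int -> int -> R[i]) : fseries :=
    fs_qpow (alpha * (2 * beta + 1) / 2)
      (fs_mulq (ps_inv euler6) (fs_sumZ3 sgn expo_q expo_x)) in
  [/\ is_Ch (calF O alpha beta) (opd O) (oph O) (rhs (fun _ _ _ => 1)),
      is_Sch (calF O alpha beta) (opNf O) (opd O) (oph O)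
        (rhs (fun i j k =>
           m1pow (alpha - 1 - 2 * beta + i%:~R - j%:~R + k%:~R))) &
      m1pow (2 * beta) = 1 ->
      is_Sch (calF O alpha beta) (opNf O) (opd O) (oph O)
        (rhs (fun i j k => m1pow (alpha - 1 + i%:~R - j%:~R + k%:~R)))].
Proof.
move=> expo_q expo_x rhs.
have m1pow_shift (z : R[i]) (n : int) : m1pow (z + 2 * n%:~R) = m1pow z.
  by rewrite m1powD m1pow_even mulr1.
have Nf_sign (p : sector) :
    m1pow (alpha - 1 - 2 * beta - p.1.1%:~R + p.1.2%:~R - p.2%:~R) =
    m1pow (alpha - 1 - 2 * beta + p.1.1%:~R - p.1.2%:~R + p.2%:~R).
  rewrite -(m1pow_shift _ (p.1.1 - p.1.2 + p.2)); congr m1pow.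
  by rewrite intrD intrB; ring.
split.
- apply: (formal_trace_calF hq0 hq (nu := fun _ => 1)) => // p l.
  by rewrite scale1r.
- apply: (formal_trace_calF hq0 hq) => [p l|p]; first exact: opNf_vec.
  exact: Nf_sign.
move=> beta1; apply: (formal_trace_calF hq0 hq) => [p l|p]; first exact: opNf_vec.
rewrite Nf_sign; set z := alpha - 1 - 2 * beta + _ - _ + _.
transitivity (m1pow (z + 2 * beta)); first by rewrite m1powD beta1 mulr1.
by congr m1pow; rewrite /z; ring.
Qed.
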